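(* Let $\Lambda=[\mu_1,L_1]\cup[\mu_2,L_2]$ with $0<\mu_1<L_1\le\mu_2<L_2$ and $L_1-\mu_1=L_2-\mu_2$. Consider the cyclical heavy ball method $\mathrm{HB}_2(h_0,h_1;m)$ with $m\in(0,1)$ and step-sizes $h_0,h_1>0$, applied to functions $f\in\mathcal{C}_\Lambda$. Define $$\sigma_2(\lambda)=2\left(\frac{1+m-\lambda h_0}{2\sqrt m}\right)\left(\frac{1+m-\lambda h_1}{2\sqrt m}\right)-1,\qquad \sigma_*=\max_{\lambda\in\left\{\mu_1,L_1,\mu_2,L_2,(1+m)\frac{h_0+h_1}{2h_0h_1}\right\}\cap\Lambda}|\sigma_2(\lambda)|.$$ Then the asymptotic rate factor of this method over $\mathcal{C}_\Lambda$ is $$1-\tau=\begin{cases}\sqrt m & \text{if } \sigma_*\le 1,\\ \sqrt m\,\big(\sigma_*+\sqrt{\sigma_*^2-1}\big)^{1/2} & \text{if } \sigma_*\in\left(1,\frac{1+m^2}{2m}\right),\\ \ge 1 \ (\text{no convergence}) & \text{if } \sigma_*\ge \frac{1+m^2}{2m}.\end{cases}$$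
   Context: For a set $\Lambda\subseteq[\mu,L]$ with $0<\mu<L$, $\mathcal{C}_\Lambda$ is the class of all quadratic functions $f:\mathbb{R}^d\to\mathbb{R}$ (any $d\ge1$) of the form $f(x)=\tfrac12(x-x_* )^\top H(x-x_* )+f_*$ with $H$ symmetric and spectrum $\mathrm{Sp}(H)\subseteq\Lambda$. For a cycle length $K\ge1$, momentum $m\in(0,1)$ and step-sizes $h_0,\dots,h_{K-1}$, the cyclical heavy ball method $\mathrm{HB}_K(h_0,\dots,h_{K-1};m)$ started at $x_0$ produces $x_1=x_0-\frac{h_0}{1+m}\nabla f(x_0)$ and, for $t\ge1$, $x_{t+1}=x_t-h_{t\bmod K}\nabla f(x_t)+m(x_t-x_{t-1})$. For a method producing iterates $(x_t)$, its worst-case rate over $\mathcal{C}_\Lambda$ is $r_t=\sup_{f\in\mathcal{C}_\Lambda,\,x_0\neq x_*}\|x_t-x_*\|/\|x_0-x_*\|$ and its asymptotic rate factor is $1-\tau=\limsup_{t\to\infty}r_t^{1/t}$. *)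

(* Defs.v *)
From HB Require Import structures.
From mathcomp Require Import all_boot all_order all_algebra.
From mathcomp Require Import all_classical all_reals all_analysis.
Set Implicit Arguments. Unset Strict Implicit. Unset Printing Implicit Defensive.
Import Order.TTheory GRing.Theory Num.Theory.
Local Open Scope classical_set_scope.
Local Open Scope ring_scope.

Section Defs.
Variable R : realType.

Definition enorm (d : nat) (v : 'cV[R]_d) : R :=
  Num.sqrt (\sum_(i < d) (v i 0) ^+ 2).

(* A quadratic f(x) = 1/2 (x-x_* )^T H (x-x_* ) + f_* is in C_Lambda iff
   H is symmetric with spectrum (set of eigenvalues) contained in Lambda.
   Its gradient is H (x - x_* ); f_* plays no role in the iterates. *)
Definition in_class (Lam : set R) (d : nat) (H : 'M[R]_d) : Prop :=
  H^T = H /\ (forall a : R, eigenvalue H a -> Lam a).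

Definition grad (d : nat) (H : 'M[R]_d) (xs x : 'cV[R]_d) : 'cV[R]_d :=
  H *m (x - xs).

(* Cyclical heavy ball HB_K(h_0..h_{K-1}; m), step-size h : nat -> R read
   modulo K.  hb_pair t = (x_t, x_{t+1}). *)
Fixpoint hb_pair (K : nat) (h : nat -> R) (m : R) (d : nat) (H : 'M[R]_d)
    (xs x0 : 'cV[R]_d) (t : nat) : 'cV[R]_d * 'cV[R]_d :=
  match t with
  | 0 => (x0, x0 - (h 0%N / (1 + m)) *: grad H xs x0)
  | t'.+1 =>
      let: (xp, xc) := hb_pair K h m H xs x0 t' in
      (xc, xc - h (t %% K)%N *: grad H xs xc + m *: (xc - xp))
  end.

Definition hb_iter K h m d H xs x0 t : 'cV[R]_d := (hb_pair K h m H xs x0 t).1.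

Definition worst_rate (Lam : set R) (K : nat) (h : nat -> R) (m : R) (t : nat)
  : \bar R :=
  ereal_sup [set r%:E | r in
    [set r : R | exists (n : nat) (H : 'M[R]_n.+1) (xs x0 : 'cV[R]_n.+1),
        in_class Lam H /\ x0 != xs /\
        r = enorm (hb_iter K h m H xs x0 t - xs) / enorm (x0 - xs)]].

Definition rate_factor (Lam : set R) (K : nat) (h : nat -> R) (m : R) : \bar R :=
  limn_esup (fun t : nat => poweR (worst_rate Lam K h m t) (t%:R)^-1).

Definition hcyc2 (h0 h1 : R) (t : nat) : R := if odd t then h1 else h0.

Definition sigma2 (m h0 h1 lam : R) : R :=
  2 * ((1 + m - lam * h0) / (2 * Num.sqrt m)) *
      ((1 + m - lam * h1) / (2 * Num.sqrt m)) - 1.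

Definition two_intervals (mu1 L1 mu2 L2 : R) : set R :=
  [set l | (mu1 <= l <= L1) \/ (mu2 <= l <= L2)].

(* sigma_* : max of |sigma2| over {mu1,L1,mu2,L2,c} ∩ Lambda, with
   c = (1+m)(h0+h1)/(2 h0 h1); mu1,L1,mu2,L2 always lie in Lambda. *)
Definition sigma_star (mu1 L1 mu2 L2 m h0 h1 : R) : R :=
  let c := (1 + m) * (h0 + h1) / (2 * h0 * h1) in
  let s := fun l => `|sigma2 m h0 h1 l| in
  let base := Num.max (Num.max (s mu1) (s L1)) (Num.max (s mu2) (s L2)) in
  if `[< two_intervals mu1 L1 mu2 L2 c >] then Num.max base (s c) else base.

End Defs.

(* Main.v *)
(* In an eigenbasis of H the error at time t is multiplied, along the eigenvalue
   lam, by a scalar p_t(lam), so the worst-case rate is the supremum of |p_t|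
   over Lam.  Along even or odd times, y_k = p_{2k+j}(lam) / m^k satisfies the
   Chebyshev recurrence y_{k+2} = 2 sigma_2(lam) y_{k+1} - y_k.  It grows at most
   linearly if |sigma_2(lam)| <= 1, and like x^k with x = |sigma_2| + sqrt
   (sigma_2^2 - 1) otherwise; the initial condition never cancels the dominant
   mode because that would force the dominant root to be m or -1.  As sigma_2 is
   a convex quadratic, sigma_* is the maximum of |sigma_2| over Lam.  Polynomial
   factors and constants disappear in the t-th root. *)

Require Import Defs.
From HB Require Import structures.
From mathcomp Require Import all_boot all_order all_algebra.
From mathcomp Require Import all_classical all_reals all_analysis.
From mathcomp Require Import complex ring lra.
Set Implicit Arguments. Unset Strict Implicit. Unset Printing Implicit Defensive.
Import Order.TTheory GRing.Theory Num.Theory.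
Local Open Scope ring_scope.

(** * Growth of solutions of the scalar Chebyshev recurrence *)

Section ChebyshevRecurrence.
Variables (R : rcfType) (s : R) (y : nat -> R).
Hypothesis recy : forall k, y k.+2 = 2 * s * y k.+1 - y k.

(** As [1 <= X], each added [D] is at most [D * X ^+ k.+1]; after division by [X ^+ k] the
    increments are at most [D] each. The case [X = 1] serves [|s| <= 1], a larger [X] the other
    case. *)
Lemma affine_growth (X D : R) :
  1 <= X -> 0 <= D -> (forall k, `|y k.+1| <= X * `|y k| + D) ->
  forall k, `|y k| <= (`|y 0%N| + k%:R * D) * X ^+ k.
Proof.
move=> X1 D0 step; elim=> [|k IH]; first by rewrite mul0r addr0 mulr1.
apply: le_trans (step k) _.
have X0 : 0 <= X by rewrite (le_trans ler01).
have DX : D <= D * X ^+ k.+1 by rewrite ler_peMr // exprn_ege1.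
apply: le_trans (lerD (ler_wpM2l X0 IH) DX) _.
by rewrite -natr1 exprS le_eqVlt; apply/orP; left; apply/eqP; ring.
Qed.

(** The roots are [s + r] and [s - r] with [r = sqrt (s^2 - 1)]; the dominant one is that in which
    [r] carries the sign of [s]. *)
Lemma char_root :
  1 <= `|s| ->
  exists2 x, x ^+ 2 + 1 = 2 * s * x & `|x| = `|s| + Num.sqrt (s ^+ 2 - 1).
Proof.
move=> s1; set r := Num.sqrt _.
have r0 : 0 <= r by exact: sqrtr_ge0.
have r2 : r ^+ 2 = s ^+ 2 - 1.
  by rewrite sqr_sqrtr // subr_ge0 -real_normK ?num_real // exprn_ege1.
have [s0|s0] := leP 0 s.
  by exists (s + r); [move: r2; nra | rewrite !ger0_norm // addr_ge0].
exists (s - r); first by move: r2; nra.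
by rewrite !ltr0_norm //; lra.
Qed.

(* For [|s| <= 1] the quantity [(y (k+1) - s y k)^2 + (1 - s^2) (y k)^2] is
   conserved, so [y] grows at most linearly; for [|s| > 1] the sequence
   [y (k+1) - x y k], with [x] the dominant characteristic root, is multiplied
   by [x^-1] at each step. *)
Lemma recurrence_upper (S B : R) (xi := S + Num.sqrt (S ^+ 2 - 1)) :
  1 <= S -> `|s| <= S -> `|y 0%N| <= B -> `|y 1%N| <= B ->
  forall k, `|y k| <= 3 * xi * B * k.+1%:R * xi ^+ k.
Proof.
move=> S1 sS y0B y1B k.
have B0 : 0 <= B by rewrite (le_trans _ y0B).
have Sxi : S <= xi by rewrite lerDl sqrtr_ge0.
have xi1 : 1 <= xi by rewrite (le_trans S1).
have [s1|s1] := leP `|s| 1.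
  have inv j : (y j.+1 - s * y j) ^+ 2 + (1 - s ^+ 2) * y j ^+ 2 =
      (y 1%N - s * y 0%N) ^+ 2 + (1 - s ^+ 2) * y 0%N ^+ 2.
    by elim: j => [//|j <-]; rewrite recy; ring.
  have s2 : s ^+ 2 <= 1 by rewrite -real_normK ?num_real // exprn_ile1.
  (* The conserved quantity is at most [(2 B)^2 + B^2], hence below [(3 B)^2]. *)
  have w j : `|y j.+1 - s * y j| <= 3 * B.
    rewrite -ler_sqr ?nnegrE ?mulr_ge0 // real_normK ?num_real //.
    apply: (@le_trans _ _ ((y 1%N - s * y 0%N) ^+ 2 + (1 - s ^+ 2) * y 0%N ^+ 2)).
      by rewrite -(inv j) lerDl mulr_ge0 ?sqr_ge0 // subr_ge0.
    have w0 : `|y 1%N - s * y 0%N| <= 2 * B.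
      apply: le_trans (ler_normB _ _) _; rewrite normrM mulrDl mul1r lerD //.
      by apply: le_trans y0B; rewrite ler_piMl.
    rewrite (_ : (3 * B) ^+ 2 = (2 * B) ^+ 2 + B ^+ 2 + 4 * B ^+ 2); last ring.
    rewrite ler_wpDr ?mulr_ge0 ?sqr_ge0 // lerD //.
      by rewrite -real_normK ?num_real // ler_sqr ?nnegrE ?mulr_ge0.
    apply: (@le_trans _ _ (y 0%N ^+ 2)).
      by rewrite ler_piMl ?sqr_ge0 // gerBl sqr_ge0.
    by rewrite -real_normK ?num_real // ler_sqr ?nnegrE.
  have step j : `|y j.+1| <= 1 * `|y j| + 3 * B.
    rewrite -[y j.+1](subrK (s * y j)) addrC.
    apply: le_trans (ler_normD _ _) _; rewrite lerD //.
    by rewrite normrM ler_wpM2r.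
  have := affine_growth (lexx 1) (mulr_ge0 (ler0n _ 3) B0) step k.
  rewrite expr1n mulr1 => /le_trans; apply.
  have xik : 1 <= xi * xi ^+ k by rewrite -exprS exprn_ege1.
  have kB : 0 <= 3 * B * k.+1%:R by rewrite !mulr_ge0.
  rewrite (_ : 3 * xi * B * _ * _ = (3 * B * k.+1%:R) * (xi * xi ^+ k)); last ring.
  apply: le_trans (ler_peMr kB xik); rewrite -[k.+1%:R]natr1.
  have k0 : 0 <= k%:R :> R by [].
  by move: y0B B0 k0; nra.
have [x xE xN] := char_root (ltW s1).
(* The growth factor increases with [|s|], so every constant below depends on [S] and [B] only: the
   bound is uniform in [s]. *)
have xxi : `|x| <= xi.
  rewrite xN /xi lerD // ler_wsqrtr // lerB // -[leLHS]real_normK ?num_real //.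
  by rewrite ler_sqr ?nnegrE // (le_trans ler01).
have x1 : 1 <= `|x| by rewrite xN (le_trans (ltW s1)) // lerDl sqrtr_ge0.
have x0 : x != 0 by rewrite -normr_gt0 (lt_le_trans ltr01).
have z j : `|y j.+1 - x * y j| <= 2 * xi * B.
  elim: j => [|j IH].
    apply: le_trans (ler_normB _ _) _; rewrite normrM.
    have := ler_pM (normr_ge0 x) (normr_ge0 (y 0%N)) xxi y0B.
    by move: B0 xi1 y1B; nra.
  apply: le_trans IH; rewrite recy.
  have -> : y j.+1 - x * y j = x * (2 * s * y j.+1 - y j - x * y j.+1).
    have -> : x * (2 * s * y j.+1 - y j - x * y j.+1) =
      (2 * s * x) * y j.+1 - x * y j - x ^+ 2 * y j.+1 by ring.
    by rewrite -xE; ring.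
  by rewrite normrM ler_peMl.
have step j : `|y j.+1| <= xi * `|y j| + 2 * xi * B.
  rewrite -[y j.+1](subrK (x * y j)) addrC.
  apply: le_trans (ler_normD _ _) _; rewrite lerD //.
  by rewrite normrM ler_wpM2r.
have xi0 : 0 <= xi by rewrite (le_trans ler01).
have D0 : 0 <= 2 * xi * B by rewrite !mulr_ge0.
apply: le_trans (affine_growth xi1 D0 step k) _.
rewrite ler_wpM2r ?exprn_ge0 // -[k.+1%:R]natr1.
have k0 : 0 <= k%:R :> R by [].
have BB : B <= xi * B by rewrite ler_peMl.
have : 0 <= k%:R * (xi * B) by rewrite !mulr_ge0.
by nra.
Qed.

(** The combination [x * y k.+1 - y k] is exactly geometric with ratio [x], so two consecutive terms
    cannot both be small compared with [|x| ^+ k]. *)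
Lemma recurrence_lower_hyperbolic (x : R) :
  x ^+ 2 + 1 = 2 * s * x -> 0 < `|x| -> x * y 1%N != y 0%N ->
  exists2 c, 0 < c &
    forall N, exists2 k, (N <= k)%N & c * `|x| ^+ k <= `|y k|.
Proof.
move=> xE x0 w0.
have wE k : x * y k.+1 - y k = x ^+ k * (x * y 1%N - y 0%N).
  elim: k => [|k IH]; first by rewrite mul1r.
  rewrite exprS -mulrA -IH recy.
  have -> : x * (2 * s * y k.+1 - y k) - y k.+1 =
    (2 * s * x) * y k.+1 - x * y k - y k.+1 by ring.
  by rewrite -xE; ring.
have D0 : 0 < 1 + `|x| ^+ 2 by rewrite ltr_pwDl // exprn_ge0.
(* Chosen so that the two assumed strict bounds, at [N] and [N.+1], add up exactly to the modulus of
   the geometric combination. *)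
pose c := `|x * y 1%N - y 0%N| / (1 + `|x| ^+ 2).
exists c => [|N]; first by rewrite divr_gt0 // normr_gt0 subr_eq0.
have [?|lt0] := leP (c * `|x| ^+ N) `|y N|; first by exists N.
exists N.+1 => //; rewrite leNgt; apply/negP => lt1.
have := congr1 Num.norm (wE N); apply/eqP; rewrite lt_eqF //.
apply: le_lt_trans (ler_normB _ _) _; rewrite !normrM normrX.
have -> : `|x| ^+ N * `|x * y 1%N - y 0%N| =
    `|x| * (c * `|x| ^+ N.+1) + c * `|x| ^+ N.
  have -> : `|x * y 1%N - y 0%N| = c * (1 + `|x| ^+ 2) by rewrite divfK ?gt_eqF.
  by rewrite (exprS _ N); ring.
by rewrite ltrD // ltr_pM2l.
Qed.

(** The quadratic form in the hypothesis is conserved. If two consecutive terms were below [c] in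
    modulus, then [|s| <= 1] would make the form smaller than [4 c^2], which is its value by the
    choice of [c]. *)
Lemma recurrence_lower_elliptic :
  `|s| <= 1 -> 0 < y 0%N ^+ 2 - 2 * s * y 0%N * y 1%N + y 1%N ^+ 2 ->
  exists2 c, 0 < c & forall N, exists2 k, (N <= k)%N & c <= `|y k|.
Proof.
move=> s1; set I := (X in 0 < X) => I0.
have inv k : y k ^+ 2 - 2 * s * y k * y k.+1 + y k.+1 ^+ 2 = I.
  by elim: k => [//|k <-]; rewrite recy; ring.
have [c c0 Ic] : exists2 c, 0 < c & I = 4 * c ^+ 2.
  exists (Num.sqrt I / 2); first by rewrite divr_gt0 // sqrtr_gt0.
  by rewrite expr_div_n sqr_sqrtr ?ltW //; field.
exists c => // N; have [?|lt0] := leP c `|y N|; first by exists N.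
exists N.+1 => //; rewrite leNgt; apply/negP => lt1.
have := inv N; apply/eqP; rewrite lt_eqF // Ic.
have sq a : `|a| < c -> a ^+ 2 < c ^+ 2.
  by move=> ac; rewrite -real_normK ?num_real // ltr_sqr ?nnegrE // ltW.
have : - (s * (y N * y N.+1)) <= `|y N| * `|y N.+1|.
  apply: le_trans (ler_norm _) _; rewrite normrN !normrM ler_piMl //.
have : `|y N| * `|y N.+1| < c * c by rewrite ltr_pM.
move: (sq _ lt0) (sq _ lt1).
by rewrite -!mulrA; lra.
Qed.

End ChebyshevRecurrence.

(** * Unitary diagonalization of real symmetric matrices *)

(** Over [R[i]] the matrix is hermitian, so the spectral theorem for normal matrices applies and the
    diagonal is real. [P] may stay complex, since only the moduli of coordinates matter later. *)
Lemma real_symmetric_diagonalizable (R : rcfType) (n : nat) (H : 'M[R]_n) :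
  H^T = H ->
  exists (P : 'M[R[i]]_n) (d : 'I_n -> R),
    [/\ P \is unitarymx,
        P *m map_mx (real_complex R) H =
          diag_mx (\row_i real_complex R (d i)) *m P
      & forall i, eigenvalue H (d i)].
Proof.
move=> symH; pose A := map_mx (real_complex R) H.
have hermA : A \is hermsymmx.
  apply: realsym_hermsym.
    apply/is_hermitianmxP/matrixP => i j; rewrite expr0 scale1r !mxE.
    by rewrite -[in LHS]symH mxE.
  apply/mxOverP => i j; rewrite mxE; apply/complex_realP.
  by exists (H i j).
have /hermitian_normalmx/orthomx_spectralP := hermA.
set P := spectralmx A; set D := spectral_diag A => eqA.
have uP : P \is unitarymx by exact: spectral_unitarymx.
have eqPA : P *m A = diag_mx D *m P.
  by rewrite [in LHS]eqA mulmxA mulmxA mulmxV ?spectral_unit // mul1mx.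
have Dreal i : real_complex R (complex.Re (D 0 i)) = D 0 i.
  apply: RRe_real; apply: (mxOverP (hermitian_spectral_diag_real hermA)).
exists P, (fun i => complex.Re (D 0 i)); split => //.
  suff -> : \row_i real_complex R (complex.Re (D 0 i)) = D by [].
  by apply/rowP => i; rewrite mxE Dreal.
move=> i; rewrite -(eigenvalue_map (real_complex R)) [X in eigenvalue _ X]Dreal.
(* Eigenvectors are row vectors here: row [i] of [P] is one, nonzero because [P] is invertible. *)
apply/eigenvalueP; exists (row i P).
  by rewrite -row_mul eqPA; apply/rowP => j; rewrite mul_diag_mx !mxE.
apply/eqP; rewrite rowE => /(congr1 (mulmx^~ (invmx P))).
rewrite mulmxK ?spectral_unit // mul0mx => /matrixP/(_ 0 i)/eqP.
by rewrite !mxE !eqxx oner_eq0.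
Qed.

Lemma unitarymx_sum_norm (C : numClosedFieldType) (n : nat) (P : 'M[C]_n)
    (v : 'cV[C]_n) :
  P \is unitarymx -> \sum_i `|(P *m v) i 0| ^+ 2 = \sum_i `|v i 0| ^+ 2.
Proof.
move=> uP.
have dot (w : 'cV[C]_n) : \sum_i `|w i 0| ^+ 2 = ((map_mx Num.conj w)^T *m w) 0 0.
  by rewrite mxE; apply: eq_bigr => i _; rewrite !mxE normCKC.
rewrite !dot map_mxM trmx_mul -mulmxA [X in _ *m X]mulmxA.
have -> : (map_mx Num.conj P)^T *m P = 1%:M.
  by rewrite map_trmx -invmx_unitary // mulVmx // unitarymx_unit.
by rewrite mul1mx.
Qed.

(** * Residual polynomials and their link with the worst-case rate *)

(** The residual polynomial of the method at [lam]: the factor multiplying the initial error along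
    an eigenvector of eigenvalue [lam]. *)
Fixpoint hb_poly (R : fieldType) (K : nat) (h : nat -> R) (m lam : R)
    (t : nat) : R :=
  match t with
  | 0 => 1
  | t'.+1 =>
      match t' with
      | 0 => 1 - h 0%N / (1 + m) * lam
      | t''.+1 => (1 + m - h (t' %% K)%N * lam) * hb_poly K h m lam t'
                  - m * hb_poly K h m lam t''
      end
  end.

Lemma hb_polySS (R : fieldType) (K : nat) (h : nat -> R) (m lam : R) (t : nat) :
  hb_poly K h m lam t.+2 =
  (1 + m - h (t.+1 %% K)%N * lam) * hb_poly K h m lam t.+1
  - m * hb_poly K h m lam t.
Proof. by []. Qed.

Section Iterates.
Variables (R : realType) (K : nat) (h : nat -> R) (m : R) (d : nat).
Variables (H : 'M[R]_d) (xs x0 : 'cV[R]_d).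
Let x := hb_iter K h m H xs x0.

Lemma hb_pairE t : hb_pair K h m H xs x0 t = (x t, x t.+1).
Proof.
by rewrite /x /hb_iter /=; case: (hb_pair _ _ _ _ _ _ t).
Qed.

Lemma hb_iter_err1 :
  x 1%N - xs = (x 0%N - xs) - (h 0%N / (1 + m)) *: (H *m (x 0%N - xs)).
Proof. by rewrite /x /hb_iter /= /grad addrAC. Qed.

Lemma hb_iter_errSS t :
  x t.+2 - xs = (1 + m) *: (x t.+1 - xs)
    - h (t.+1 %% K)%N *: (H *m (x t.+1 - xs)) - m *: (x t - xs).
Proof.
rewrite {1}/x /hb_iter /= hb_pairE /= /grad.
move: (H *m _) => v; apply/colP => i; rewrite !mxE; ring.
Qed.

Local Notation toC := (map_mx (real_complex R)).

Lemma hb_iter_coord (P : 'M[R[i]]_d) (lam : 'I_d -> R) :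
  P *m toC H = diag_mx (\row_i real_complex R (lam i)) *m P ->
  forall t i, (P *m toC (x t - xs)) i 0 =
    real_complex R (hb_poly K h m (lam i) t) * (P *m toC (x 0%N - xs)) i 0.
Proof.
move=> PH.
have PHe (v : 'cV[R]_d) i : (P *m toC (H *m v)) i 0 =
    real_complex R (lam i) * (P *m toC v) i 0.
  by rewrite map_mxM mulmxA PH -mulmxA mul_diag_mx !mxE.
have [w wE] : exists w, forall i, (P *m toC (x 0%N - xs)) i 0 = w i.
  by exists (fun i => (P *m toC (x 0%N - xs)) i 0).
(* The recurrence has order two, so consecutive times are treated together. *)
suff main t i :
    (P *m toC (x t - xs)) i 0 =
      real_complex R (hb_poly K h m (lam i) t) * w i /\
    (P *m toC (x t.+1 - xs)) i 0 =
      real_complex R (hb_poly K h m (lam i) t.+1) * w i.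
  by move=> t i; rewrite wE; have [] := main t i.
have entryB (u v : 'cV[R[i]]_d) j : (u - v) j 0 = u j 0 - v j 0 by rewrite !mxE.
have entryZ a (u : 'cV[R[i]]_d) j : (a *: u) j 0 = a * u j 0 by rewrite mxE.
elim: t => [|t [IH0 IH1]].
  split; first by rewrite rmorph1 mul1r wE.
  rewrite hb_iter_err1 map_mxB map_mxZ mulmxBr -scalemxAr.
  rewrite entryB entryZ PHe wE /hb_poly rmorphB rmorph1 mulrBl mul1r.
  by congr (_ - _); rewrite !rmorphM !mulrA.
split; first exact: IH1.
rewrite hb_iter_errSS hb_polySS.
move: (x t.+1 - xs) (x t - xs) IH0 IH1 => u v IH0 IH1.
rewrite !map_mxB !map_mxZ !mulmxBr -!scalemxAr.
rewrite !entryB !entryZ PHe IH0 IH1.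
by rewrite !(rmorphB, rmorphD, rmorph1, rmorphM); ring.
Qed.

End Iterates.

Lemma enorm_ge0 (R : realType) (d : nat) (v : 'cV[R]_d) : 0 <= enorm v.
Proof. exact: sqrtr_ge0. Qed.

(** In the coordinates given by [P] the error is scaled entrywise by factors of modulus at most [M],
    and a unitary matrix preserves the sum of squared moduli. *)
Lemma enorm_hb_iter_le (R : realType) (Lam : set R) (K : nat) (h : nat -> R)
    (m : R) (d : nat) (H : 'M[R]_d) (xs x0 : 'cV[R]_d) (t : nat) (M : R) :
  in_class Lam H -> (forall lam, Lam lam -> `|hb_poly K h m lam t| <= M) ->
  0 <= M ->
  enorm (hb_iter K h m H xs x0 t - xs) <= M * enorm (x0 - xs).
Proof.
move=> [symH specH] leM M0.
have [P [lam [uP PH eigH]]] := real_symmetric_diagonalizable symH.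
have coord := hb_iter_coord K h m xs x0 PH t.
rewrite [leRHS](_ : _ = Num.sqrt (M ^+ 2 * \sum_i (x0 - xs) i 0 ^+ 2)); last first.
  by rewrite sqrtrM ?sqr_ge0 // sqrtr_sqr ger0_norm.
rewrite /enorm ler_wsqrtr // -lecR rmorphM /= !rmorph_sum /=.
have toCE (v : 'cV[R]_d) : \sum_i real_complex R (v i 0 ^+ 2) =
    \sum_i `|(P *m map_mx (real_complex R) v) i 0| ^+ 2.
  rewrite unitarymx_sum_norm //; apply: eq_bigr => i _.
  rewrite mxE rmorphXn /= normc_def /= expr0n addr0 sqrtr_sqr.
  by rewrite -!rmorphXn /= real_normK ?num_real.
rewrite !toCE mulr_sumr; apply: ler_sum => i _.
rewrite coord normrM exprMn ler_wpM2r ?exprn_ge0 //.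
rewrite normc_def /= expr0n addr0 sqrtr_sqr -rmorphXn lecR.
by rewrite ler_sqr ?nnegrE // leM //; exact/specH/eigH.
Qed.

Lemma eigenvalue_scalar_mx (F : fieldType) (n : nat) (a b : F) :
  eigenvalue (a%:M : 'M[F]_n) b -> b = a.
Proof.
move=> /eigenvalueP[v]; rewrite mul_mx_scalar => /eqP; rewrite -subr_eq0.
by rewrite -scalerBl scaler_eq0 subr_eq0 => /orP[/eqP ->|/eqP-> /eqP].
Qed.

(** A one-dimensional quadratic of curvature [lam], with minimizer 0 and starting point 1, has the
    values of [hb_poly] as iterates. *)
Lemma worst_rate_ge (R : realType) (Lam : set R) (K : nat) (h : nat -> R)
    (m lam : R) (t : nat) :
  Lam lam -> (`|hb_poly K h m lam t|%:E <= worst_rate Lam K h m t)%E.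
Proof.
move=> Llam; apply: ereal_sup_ubound; exists `|hb_poly K h m lam t| => //.
pose x0 : 'cV[R]_1 := const_mx 1.
exists 0%N, lam%:M, 0, x0; split; last split.
- by split; [rewrite tr_scalar_mx | move=> a /eigenvalue_scalar_mx ->].
- by apply/eqP => /colP/(_ 0); rewrite !mxE => /eqP; rewrite oner_eq0.
have x0E : enorm (x0 - 0) = 1.
  by rewrite /enorm big_ord1 !mxE subr0 expr1n sqrtr1.
rewrite x0E divr1.
suff -> : hb_iter K h m lam%:M 0 x0 t - 0 = const_mx (hb_poly K h m lam t).
  by rewrite /enorm big_ord1 mxE sqrtr_sqr.
suff [] : hb_iter K h m lam%:M 0 x0 t - 0 = const_mx (hb_poly K h m lam t) /\
  hb_iter K h m lam%:M 0 x0 t.+1 - 0 = const_mx (hb_poly K h m lam t.+1) by [].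
have x0C : hb_iter K h m lam%:M 0 x0 0 - 0 = const_mx 1 by rewrite subr0.
elim: t => [|t [IH0 IH1]].
  split=> //; rewrite hb_iter_err1 x0C mul_scalar_mx.
  by apply/colP => i; rewrite !mxE mulr1.
split=> //; rewrite hb_iter_errSS IH0 IH1 mul_scalar_mx hb_polySS.
by apply/colP => i; rewrite !mxE; ring.
Qed.

Lemma worst_rate_ge0 (R : realType) (Lam : set R) (K : nat) (h : nat -> R)
    (m lam : R) (t : nat) :
  Lam lam -> (0 <= worst_rate Lam K h m t)%E.
Proof.
by move=> Llam; apply: le_trans (worst_rate_ge K h m t Llam); rewrite lee_fin.
Qed.

Lemma worst_rate_le (R : realType) (Lam : set R) (K : nat) (h : nat -> R)
    (m : R) (t : nat) (M : R) :
  (forall lam, Lam lam -> `|hb_poly K h m lam t| <= M) -> 0 <= M ->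
  (worst_rate Lam K h m t <= M%:E)%E.
Proof.
move=> leM M0; apply: ge_ereal_sup => _ [_ [n [H [xs [x0 [HL [x0xs ->]]]]]] <-].
have := enorm_hb_iter_le xs x0 HL leM M0.
rewrite lee_fin; have [->|e0 le] := eqVneq (enorm (x0 - xs)) 0.
  (* Division by zero yields 0, which is at most [M]. *)
  by rewrite invr0 !mulr0.
by rewrite ler_pdivrMr // lt_neqAle eq_sym e0 enorm_ge0.
Qed.

(** * Limit superior of [t]-th roots *)

(** Bernoulli's inequality for [Num.sqrt q], once squared, gives a quadratic lower bound on
    [q ^+ t], which beats the linear term. *)
Lemma linear_le_exp (R : realType) (C q : R) : 1 < q ->
  exists N : nat, forall t : nat, (N <= t)%N -> C * t.+1%:R <= q ^+ t.
Proof.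
move=> q1; pose e := Num.sqrt q - 1.
have e0 : 0 < e by rewrite subr_gt0 -sqrtr1 ltr_sqrt // (lt_trans ltr01).
have bern t : 1 + t%:R * e <= Num.sqrt q ^+ t.
  elim: t => [|t IH]; first by rewrite mul0r addr0 expr0.
  have t0 : 0 <= t%:R :> R by [].
  have s0 : 0 <= Num.sqrt q by exact: sqrtr_ge0.
  rewrite exprS (le_trans _ (ler_wpM2l s0 IH)) //.
  rewrite (_ : Num.sqrt q = 1 + e); last by rewrite /e addrC subrK.
  rewrite -natr1; nra.
(* For [t >= 1] beyond this threshold, [C (t + 1) <= 2 |C| t <= (t e)^2]. *)
have [N NC] : exists N : nat, `|C| * 2 / e ^+ 2 <= N%:R.
  exists (Num.trunc (`|C| * 2 / e ^+ 2)).+1; apply/ltW/truncnS_gt.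
exists N.+1 => t Nt.
have t1 : 1 <= t%:R :> R by rewrite ler1n (leq_trans _ Nt).
have tC : `|C| * 2 <= t%:R * e ^+ 2.
  rewrite -ler_pdivrMr ?exprn_gt0 //; apply: le_trans NC _.
  by rewrite ler_nat (leq_trans _ Nt).
have -> : q ^+ t = (Num.sqrt q ^+ t) ^+ 2.
  by rewrite -exprM mulnC exprM sqr_sqrtr // ltW // (lt_trans ltr01).
apply: (@le_trans _ _ ((t%:R * e) ^+ 2)); last first.
  rewrite lerXn2r ?nnegrE ?mulr_ge0 ?exprn_ge0 ?sqrtr_ge0 ?(ltW e0) //.
  by apply: le_trans (bern t); rewrite lerDr.
rewrite -natr1 exprMn expr2 -mulrA.
have : C <= `|C| := ler_norm C.
have : 0 <= `|C| := normr_ge0 C.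
by nra.
Qed.

(** For every [e > 0] the factor [C * t.+1%:R] is eventually absorbed by
    [((rho + e) / rho) ^+ t]. *)
Lemma limn_esup_root_le (R : realType) (u : nat -> \bar R) (C rho : R) :
  0 < rho -> (forall t, 0 <= u t)%E ->
  (forall t, u t <= (C * t.+1%:R * rho ^+ t)%:E)%E ->
  (limn_esup (fun t => poweR (u t) (t%:R)^-1) <= rho%:E)%E.
Proof.
move=> rho0 u0 uC; apply/lee_addgt0Pr => e e0.
have q1 : 1 < (rho + e) / rho by rewrite ltr_pdivlMr // mul1r ltrDl.
have re0 : 0 <= rho + e by rewrite ltW // addr_gt0.
have [N HN] := linear_le_exp C q1.
rewrite /limn_esup limf_esupE.
apply: (@le_trans _ _ (ereal_sup
  [set poweR (u t) (t%:R)^-1 | t in [set t | (N < t)%N]]))%classic.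
  (* The strict inequality also discards [t = 0], whose exponent is the default [0^-1 = 0]. *)
  apply: ereal_inf_lbound; exists [set t | (N < t)%N]%classic => //.
  by exists N.+1.
apply: ge_ereal_sup => _ [t /= Nt <-].
have tn0 : t%:R != 0 :> R by rewrite pnatr_eq0 -lt0n (leq_trans _ Nt).
have le_u : (u t <= ((rho + e) ^+ t)%:E)%E.
  apply: le_trans (uC t) _; rewrite lee_fin.
  rewrite -ler_pdivlMr ?exprn_gt0 // -expr_div_n.
  exact/HN/ltnW.
have -> : (rho%:E + e%:E)%E = poweR ((rho + e) ^+ t)%:E (t%:R)^-1.
  by rewrite poweR_EFin -powR_mulrn // -powRrM mulfV // powRr1.
apply: gt0_ler_poweR => //; rewrite ?invr_ge0 // !in_itv /= leey andbT.
  exact: u0.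
by rewrite lee_fin exprn_ge0.
Qed.

(** Arbitrarily late times suffice, because every tail then contains one at which [c * rho ^+ t]
    exceeds [(rho - e) ^+ t]. *)
Lemma limn_esup_root_ge (R : realType) (u : nat -> \bar R) (c rho : R) :
  0 < c -> 0 < rho ->
  (forall N, exists2 t, (N <= t)%N & ((c * rho ^+ t)%:E <= u t)%E) ->
  (rho%:E <= limn_esup (fun t => poweR (u t) (t%:R)^-1))%E.
Proof.
move=> c0 rho0 uc; rewrite /limn_esup limf_esupE.
apply: le_ereal_inf_tmp => _ [A [N _ NA] <-].
apply/lee_subgt0Pr => e e0.
(* When [rho <= e] the target is nonpositive, while the roots are nonnegative. *)
have [e_ge|e_lt] := leP rho e.
  have [t Nt _] := uc N.
  apply: (@le_trans _ _ 0%E); first by rewrite -EFinB lee_fin subr_le0.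
  apply: (@le_trans _ _ (poweR (u t) (t%:R)^-1)); first exact: poweR_ge0.
  by apply: ereal_sup_ubound; exists t => //; apply: NA.
have re0 : 0 < rho - e by rewrite subr_gt0.
have q1 : 1 < rho / (rho - e) by rewrite ltr_pdivlMr // mul1r gtrBl.
have [N' HN'] := linear_le_exp c^-1 q1.
have [t Nt ut] := uc (maxn N'.+1 N).
move: Nt; rewrite geq_max => /andP[N't Nt].
have tn0 : t%:R != 0 :> R by rewrite pnatr_eq0 -lt0n (leq_trans _ N't).
apply: (@le_trans _ _ (poweR (u t) (t%:R)^-1)); last first.
  by apply: ereal_sup_ubound; exists t => //; apply: NA.
have le_u : (((rho - e) ^+ t)%:E <= u t)%E.
  apply: le_trans ut; rewrite lee_fin.
  rewrite mulrC -ler_pdivrMr // mulrC -ler_pdivlMr ?exprn_gt0 // -expr_div_n.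
  apply: le_trans (HN' _ (ltnW N't)); rewrite ler_peMr ?invr_ge0 ?(ltW c0) //.
  by rewrite ler1n.
have -> : (rho%:E - e%:E)%E = poweR ((rho - e) ^+ t)%:E (t%:R)^-1.
  by rewrite poweR_EFin -powR_mulrn ?(ltW re0) // -powRrM mulfV // powRr1 ?(ltW re0).
apply: gt0_ler_poweR => //; rewrite ?invr_ge0 // !in_itv /= leey andbT.
  by rewrite lee_fin exprn_ge0 // ltW.
by apply: le_trans le_u; rewrite lee_fin exprn_ge0 // ltW.
Qed.

(** * Residual polynomials of the cycle of length two *)

Section TwoCycle.
Variables (R : realType) (m h0 h1 : R).
Hypotheses (m0 : 0 < m) (m1 : m < 1) (h0_gt0 : 0 < h0) (h1_gt0 : 0 < h1).

Local Notation sigma := (sigma2 m h0 h1).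
Local Notation p := (hb_poly 2 (hcyc2 h0 h1) m).
Local Notation growth s := (s + Num.sqrt (s ^+ 2 - 1)).

Lemma sigma2E lam :
  sigma lam = (1 + m - h0 * lam) * (1 + m - h1 * lam) / (2 * m) - 1.
Proof.
have sm0 : Num.sqrt m != 0 by rewrite sqrtr_eq0 -ltNge.
have E a b : 2 * (a / (2 * Num.sqrt m)) * (b / (2 * Num.sqrt m)) =
    a * b / (2 * m).
  by rewrite -[in RHS](sqr_sqrtr (ltW m0)); field.
by rewrite /sigma2 E ![lam * _]mulrC.
Qed.

Lemma hb_poly_recS lam t :
  p lam t.+2 = (1 + m - (if odd t then h0 else h1) * lam) * p lam t.+1
               - m * p lam t.
Proof. by rewrite hb_polySS /hcyc2 modn2 oddb /=; case: (odd t). Qed.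

(** Eliminating the intermediate terms from three consecutive recurrences leaves the trace and
    determinant of a two-step transfer matrix: [2 * m * sigma lam] and [m ^+ 2]. Both are symmetric
    in [h0] and [h1], so the parity of [t] does not matter. *)
Lemma hb_poly_two_step lam t :
  p lam t.+4 = 2 * m * sigma lam * p lam t.+2 - m ^+ 2 * p lam t.
Proof.
have -> : 2 * m * sigma lam =
    (1 + m - h0 * lam) * (1 + m - h1 * lam) - 2 * m.
  by rewrite sigma2E; field; rewrite gt_eqF.
rewrite (hb_poly_recS lam t.+2) (hb_poly_recS lam t.+1) (hb_poly_recS lam t).
by move: (p lam t) (p lam t.+1) => a b; rewrite /= negbK; case: (odd t) => /=; ring.
Qed.

(** The factor [1 / (1 + m)] of the first step makes this value depend on [lam] through [sigma lam]
    only; with [p lam 0 = 1] it starts the even subsequence. *)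
Lemma hb_poly2 lam : p lam 2 = m * (2 * (sigma lam + 1) / (1 + m) - 1).
Proof.
have m1n : 1 + m != 0 by rewrite gt_eqF // addr_gt0.
rewrite hb_poly_recS sigma2E /= {1}/hcyc2 /=.
by field; rewrite m1n gt_eqF.
Qed.

(** Times 0 to 3 supply the two initial values of the even and of the odd subsequence, here bounded
    uniformly in [lam]. *)
Lemma hb_poly_crude_bound (L : R) : exists B : R, forall (lam : R) t,
  0 <= lam <= L -> (t < 4)%N -> `|p lam t| <= B.
Proof.
(* [A] bounds both coefficients [1 + m - h * lam]; then [A (A + 1) + 1 <= (A + 1)^2] propagates the
   bound by powers of [A + 1]. *)
pose A := 2 + (h0 + h1) * `|L|.
exists ((A + 1) ^+ 3) => lam t /andP[lam0 lamL] t4.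
have L0 : 0 <= (h0 + h1) * `|L| by rewrite mulr_ge0 // addr_ge0 // ltW.
have m1_ge0 : 0 <= 1 + m by rewrite addr_ge0 // ltW.
have A0 : 0 <= A by rewrite addr_ge0.
have A1 : 1 <= A + 1 by rewrite lerDr.
have coef h : 0 < h -> h <= h0 + h1 -> `|1 + m - h * lam| <= A.
  move=> hp hs; apply: le_trans (ler_normB _ _) _.
  rewrite /A lerD //; first by rewrite ger0_norm // lerD // ltW.
  rewrite ger0_norm ?mulr_ge0 ?(ltW hp) //.
  by rewrite ler_pM ?(ltW hp) // (le_trans lamL) // ler_norm.
have c0 : `|1 + m - h0 * lam| <= A by apply: coef => //; rewrite lerDl ltW.
have c1 : `|1 + m - h1 * lam| <= A by apply: coef => //; rewrite lerDr ltW.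
have b1 : `|p lam 1| <= A + 1.
  have -> : p lam 1 = (1 + m - h0 * lam) / (1 + m).
    by rewrite /= /hcyc2 /=; field; rewrite gt_eqF // addr_gt0.
  rewrite normrM normfV [`|1 + m|]ger0_norm //.
  rewrite ler_pdivrMr ?addr_gt0 //; apply: le_trans c0 _.
  by move: m0 A0; nra.
have step j : `|p lam j| <= (A + 1) ^+ j -> `|p lam j.+1| <= (A + 1) ^+ j.+1 ->
    `|p lam j.+2| <= (A + 1) ^+ j.+2.
  move=> IH0 IH1; rewrite hb_poly_recS.
  apply: le_trans (ler_normB _ _) _; rewrite !normrM [`|m|]gtr0_norm //.
  have cj : `|1 + m - (if odd j then h0 else h1) * lam| <= A by case: (odd j).
  have e1 := ler_pM (normr_ge0 _) (normr_ge0 _) cj IH1.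
  have e0 : m * `|p lam j| <= 1 * (A + 1) ^+ j.
    by rewrite ler_pM // ltW.
  apply: le_trans (lerD e1 e0) _.
  rewrite exprS mul1r [X in _ <= X]exprS.
  have : 0 <= (A + 1) ^+ j by rewrite exprn_ge0 // (le_trans ler01).
  by rewrite -exprS [(A + 1) ^+ j.+1]exprS; nra.
have b t' : `|p lam t'| <= (A + 1) ^+ t' /\ `|p lam t'.+1| <= (A + 1) ^+ t'.+1.
  elim: t' => [|j [IH0 IH1]]; first by rewrite expr0 expr1 normr1.
  by split=> //; exact: step.
have [+ _] := b t; move=> /le_trans; apply.
by rewrite ler_weXn2l.
Qed.

Lemma hb_poly_subseq_rec lam j k (y := fun i => p lam (i.*2 + j)%N / m ^+ i) :
  y k.+2 = 2 * sigma lam * y k.+1 - y k.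
Proof.
rewrite /y !doubleS !addSn hb_poly_two_step.
have mk : m ^+ k != 0 by rewrite expf_neq0 // gt_eqF.
by rewrite (exprS _ k.+1) (exprS _ k); field; rewrite mk gt_eqF.
Qed.

Lemma growth_ge1 (s : R) : 1 <= s -> 1 <= growth s.
Proof. by move=> s1; rewrite (le_trans s1) // lerDl sqrtr_ge0. Qed.

Lemma sqrtm_gt0 : 0 < Num.sqrt m. Proof. by rewrite sqrtr_gt0. Qed.

(** The constant must not depend on [lam], because the worst-case rate takes a supremum at each
    fixed time. *)
Lemma hb_poly_upper (L S : R) (rho := Num.sqrt m * Num.sqrt (growth S)) :
  1 <= S -> exists2 C : R, 0 <= C & forall (lam : R) t, 0 <= lam <= L ->
    `|sigma lam| <= S -> `|p lam t| <= C * t.+1%:R * rho ^+ t.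
Proof.
move=> S1; set xi := growth S in rho *.
have xi1 : 1 <= xi := growth_ge1 S1.
have xi0 : 0 < xi := lt_le_trans ltr01 xi1.
have [B HB] := hb_poly_crude_bound `|L|.
have B0 : 0 <= B by apply: le_trans (HB 0 0%N _ _); rewrite ?lexx ?normr_ge0.
have sm := sqrtm_gt0.
have sm1 : Num.sqrt m <= 1 by rewrite -sqrtr1 ler_wsqrtr // ltW.
have rhom : Num.sqrt m <= rho.
  by rewrite ler_peMr ?(ltW sm) // -sqrtr1 ler_wsqrtr.
have rho2 : rho ^+ 2 = m * xi by rewrite exprMn !sqr_sqrtr // ltW.
(* [B / m] bounds the normalized initial values for both parities; [1 / Num.sqrt m] compensates the
   factor [rho ^+ j], which is at least [Num.sqrt m]. *)
exists (3 * xi * (B / m) / Num.sqrt m) => [|lam t /andP[lam0 lamL] sS].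
  by rewrite !mulr_ge0 ?invr_ge0 ?(ltW m0) ?(ltW sm) ?(ltW xi0).
have lamL' : 0 <= lam <= `|L| by rewrite lam0 (le_trans lamL) // ler_norm.
pose k := t./2; pose j : nat := odd t.
have tE : t = (k.*2 + j)%N by rewrite addnC odd_double_half.
have j1 : (j <= 1)%N by rewrite /j; case: (odd t).
have y0B : `|p lam (0.*2 + j) / m ^+ 0| <= B / m.
  rewrite expr0 divr1; apply: le_trans (HB _ _ lamL' _) _.
    by rewrite add0n (leq_ltn_trans j1).
  by rewrite ler_pdivlMr // ler_piMr // ltW.
have y1B : `|p lam (1.*2 + j) / m ^+ 1| <= B / m.
  rewrite expr1 normrM normfV [`|m|]gtr0_norm // ler_pM2r ?invr_gt0 //.
  by apply: HB lamL' _; rewrite ltnS (leq_add2l 2 j 1).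
have := recurrence_upper (hb_poly_subseq_rec lam j) S1 sS y0B y1B k.
rewrite -tE -/xi normrM normfV normrX [`|m|]gtr0_norm //.
rewrite ler_pdivrMr ?exprn_gt0 // => /le_trans; apply.
have -> : rho ^+ t = m ^+ k * xi ^+ k * rho ^+ j.
  by rewrite [in LHS]tE exprD -mul2n exprM rho2 exprMn.
have rhoj : Num.sqrt m <= rho ^+ j.
  by rewrite /j; case: (odd t).
have kt : k.+1%:R <= t.+1%:R :> R.
  by rewrite ler_nat ltnS tE -addnn -addnA leq_addr.
have xk : 0 <= xi ^+ k by rewrite exprn_ge0 // ltW.
have mk : 0 <= m ^+ k by rewrite exprn_ge0 // ltW.
have D0 : 0 <= 3 * xi * (B / m).
  by rewrite !mulr_ge0 ?invr_ge0 ?(ltW m0) ?(ltW xi0).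
move: (3 * xi * (B / m)) D0 => D D0.
have -> : D / Num.sqrt m * t.+1%:R * (m ^+ k * xi ^+ k * rho ^+ j) =
    (D * (m ^+ k * xi ^+ k)) * (t.+1%:R * (rho ^+ j / Num.sqrt m)) by ring.
have -> : D * k.+1%:R * xi ^+ k * m ^+ k =
    (D * (m ^+ k * xi ^+ k)) * k.+1%:R by ring.
rewrite ler_wpM2l ?mulr_ge0 //; apply: (le_trans kt).
by rewrite ler_peMr // ler_pdivlMr // mul1r.
Qed.

Lemma hb_poly_lower_of_even (lam x : R) : 0 < x ->
  (exists2 c, 0 < c & forall N, exists2 k, (N <= k)%N &
     c * x ^+ k <= `|p lam (k.*2 + 0) / m ^+ k|) ->
  exists2 c, 0 < c & forall N, exists2 t, (N <= t)%N &
     c * (Num.sqrt m * Num.sqrt x) ^+ t <= `|p lam t|.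
Proof.
move=> x0 [c c0 Hc]; exists c => // N; have [k Nk] := Hc N.
rewrite addn0 normrM normfV normrX [`|m|]gtr0_norm // ler_pdivlMr ?exprn_gt0 //.
move=> le_k; exists k.*2; first by rewrite (leq_trans Nk) // -addnn leq_addr.
have rho2 : (Num.sqrt m * Num.sqrt x) ^+ 2 = x * m.
  by rewrite exprMn !sqr_sqrtr ?ltW // mulrC.
by rewrite -[in X in X <= _]mul2n exprM rho2 exprMn mulrA.
Qed.

Lemma hb_poly_lower_hyperbolic lam (s := `|sigma lam|) : 1 < s ->
  exists2 c, 0 < c & forall N, exists2 t, (N <= t)%N &
    c * (Num.sqrt m * Num.sqrt (growth s)) ^+ t <= `|p lam t|.
Proof.
move=> s1; have [x xE xN] := char_root (ltW s1).
have xs : `|x| = growth s by rewrite xN /s real_normK ?num_real.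
have gt1 : 1 < growth s by rewrite (lt_le_trans s1) // lerDl sqrtr_ge0.
have x1 : 1 < `|x| by rewrite xs.
have m1n : 1 + m != 0 by rewrite gt_eqF // addr_gt0.
apply: hb_poly_lower_of_even; first exact: lt_trans gt1.
rewrite -xs; apply: (recurrence_lower_hyperbolic (hb_poly_subseq_rec lam 0) xE).
  exact: lt_trans x1.
rewrite /= -/(p lam 2) hb_poly2 expr0 expr1 divr1 [m * _]mulrC mulfK ?lt0r_neq0 //.
(* The dominant mode is absent only for [x = m] or [x = -1]. *)
have -> : x * (2 * (sigma lam + 1) / (1 + m) - 1) =
    (2 * sigma lam * x + 2 * x) / (1 + m) - x by field.
rewrite -xE; apply/eqP => /(congr1 (fun z => (z + x) * (1 + m))).
rewrite subrK divfK // => eq1.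
have : (x + 1) * (x - m) = 0.
  rewrite (_ : (x + 1) * (x - m) = x ^+ 2 + 1 + 2 * x - (1 + x) * (1 + m)); last ring.
  by rewrite eq1 subrr.
move=> /eqP; rewrite mulf_eq0 addr_eq0 subr_eq0 => /orP[]/eqP xv; move: x1.
  by rewrite xv normrN1 ltxx.
by rewrite xv gtr0_norm // ltNge ltW.
Qed.

(** On the even subsequence the conserved form is positive; it would vanish at [sigma lam = -1]. *)
Lemma hb_poly_lower_elliptic lam : `|sigma lam| <= 1 -> sigma lam != -1 ->
  exists2 c, 0 < c & forall N, exists2 t, (N <= t)%N &
    c * Num.sqrt m ^+ t <= `|p lam t|.
Proof.
move=> s1 sN1.
suff : exists2 c, 0 < c & forall N, exists2 t, (N <= t)%N &
    c * (Num.sqrt m * Num.sqrt 1) ^+ t <= `|p lam t| by rewrite sqrtr1 mulr1.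
apply: hb_poly_lower_of_even => //.
have [|c c0 Hc] := @recurrence_lower_elliptic _ _ _ (hb_poly_subseq_rec lam 0) s1.
- rewrite /= -/(p lam 2) hb_poly2 expr0 expr1 divr1 [m * _]mulrC mulfK ?lt0r_neq0 //.
  set z := 2 * _ / _ - 1.
  (* The last term is positive when [|sigma lam| < 1]; at [sigma lam = 1] the square is, since
     [z - 1 = 2 (1 - m) / (1 + m)]. *)
  rewrite (_ : _ + _ = (z - sigma lam) ^+ 2 + (1 - sigma lam ^+ 2)); last ring.
  move: s1; rewrite ler_norml => /andP[sl su].
  have [s_eq1|s_neq1] := eqVneq (sigma lam) 1.
    rewrite s_eq1 expr1n subrr addr0 exprn_even_gt0 //= /z s_eq1.
    rewrite (_ : _ - _ - _ = 2 * (1 - m) / (1 + m)); last first.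
      by field; rewrite gt_eqF // addr_gt0.
    by rewrite !mulf_neq0 ?invr_eq0 ?subr_eq0 ?gt_eqF ?addr_gt0.
  have sl' : -1 < sigma lam by rewrite lt_neqAle eq_sym sN1.
  have su' : sigma lam < 1 by rewrite lt_neqAle s_neq1.
  rewrite ltr_wpDl ?sqr_ge0 //; move: sl' su'; nra.
- exists c => // N; have [k Nk ck] := Hc N; exists k => //.
  by rewrite expr1n mulr1.
Qed.

End TwoCycle.

(** * Maximum of [|sigma2|] over the two intervals *)

(** [f] increases with the distance to [c]: on the interval its maximum is at an endpoint and its
    minimum at the point nearest to [c], namely [c] itself or an endpoint. *)
Lemma sqr_dist_bound (R : realFieldType) (alpha beta c a b M : R)
    (f := fun x => alpha * (x - c) ^+ 2 + beta) :
  0 <= alpha -> `|f a| <= M -> `|f b| <= M ->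
  (a <= c -> c <= b -> `|f c| <= M) ->
  forall x, a <= x -> x <= b -> `|f x| <= M.
Proof.
move=> al0 faM fbM fcM x ax xb.
have mono u v : `|u - c| <= `|v - c| -> f u <= f v.
  move=> uv; rewrite /f lerD2r ler_wpM2l //.
  rewrite -[leLHS]real_normK ?num_real // -[leRHS]real_normK ?num_real //.
  by rewrite ler_sqr.
move: faM fbM fcM; rewrite !ler_norml => /andP[fa1 fa2] /andP[fb1 fb2] fc.
apply/andP; split.
  have [ca|ac] := ltP c a.
    by apply: le_trans fa1 _; apply: mono; rewrite !ger0_norm; lra.
  have [bc|cb] := ltP b c.
    by apply: le_trans fb1 _; apply: mono; rewrite !ler0_norm; lra.
  have /andP[fc1 _] := fc ac cb.
  by apply: le_trans fc1 _; apply: mono; rewrite subrr normr0.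
have [cx|xc] := leP c x.
  by apply: le_trans fb2; apply: mono; rewrite !ger0_norm; lra.
by apply: le_trans fa2; apply: mono; rewrite !ler0_norm; lra.
Qed.

Section SigmaStar.
Variables (R : realType) (mu1 L1 mu2 L2 m h0 h1 : R).
Hypotheses (lt1 : mu1 < L1) (lt2 : mu2 < L2).
Hypotheses (m0 : 0 < m) (h0_gt0 : 0 < h0) (h1_gt0 : 0 < h1).

Local Notation sigma := (sigma2 m h0 h1).
Local Notation Lam := (two_intervals mu1 L1 mu2 L2).
Local Notation star := (sigma_star mu1 L1 mu2 L2 m h0 h1).
Let c := (1 + m) * (h0 + h1) / (2 * h0 * h1).
Let alpha := h0 * h1 / (2 * m).

(** Completing the square shows that the fifth candidate of [sigma_star] is the vertex of the
    parabola. *)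
Lemma sigma2_vertex lam : sigma lam = alpha * (lam - c) ^+ 2 + sigma c.
Proof.
rewrite !sigma2E // /alpha /c; field.
by rewrite !gt_eqF.
Qed.

Lemma alpha_gt0 : 0 < alpha.
Proof. by rewrite divr_gt0 ?mulr_gt0. Qed.

Lemma endpoint_le_star l : l \in [:: mu1; L1; mu2; L2] -> `|sigma l| <= star.
Proof.
rewrite !inE /sigma_star; case: ifP => _ /or4P[] /eqP ->;
  by rewrite !le_max lexx ?orbT.
Qed.

Lemma vertex_le_star : Lam c -> `|sigma c| <= star.
Proof. by move=> Lc; rewrite /sigma_star asboolT // le_max lexx orbT. Qed.

Lemma sigma2_le_star lam : Lam lam -> `|sigma lam| <= star.
Proof.
have bound a b : `|sigma a| <= star -> `|sigma b| <= star ->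
    (a <= c -> c <= b -> Lam c) -> a <= lam -> lam <= b -> `|sigma lam| <= star.
  move=> sa sb sc; rewrite sigma2_vertex; apply: sqr_dist_bound => //.
  - exact/ltW/alpha_gt0.
  - by rewrite -sigma2_vertex.
  - by rewrite -sigma2_vertex.
  - by move=> ac cb; rewrite -sigma2_vertex vertex_le_star //; exact: sc.
case=> /andP[]; apply: bound; rewrite ?endpoint_le_star ?inE ?eqxx ?orbT //.
  by move=> ac cb; left; rewrite ac.
by move=> ac cb; right; rewrite ac.
Qed.

Lemma star_attained : exists2 lam, Lam lam & `|sigma lam| = star.
Proof.
have [La Lb] : Lam mu1 /\ Lam L1 by split; left; rewrite lexx ltW.
have [Lc Ld] : Lam mu2 /\ Lam L2 by split; right; rewrite lexx ltW.
have ex_max a b : (exists2 lam, Lam lam & `|sigma lam| = a) ->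
    (exists2 lam, Lam lam & `|sigma lam| = b) ->
    exists2 lam, Lam lam & `|sigma lam| = Num.max a b.
  by rewrite maxEle; case: ifP.
have ex l : Lam l -> exists2 lam, Lam lam & `|sigma lam| = `|sigma l|.
  by exists l.
have base : exists2 lam, Lam lam & `|sigma lam| =
    Num.max (Num.max `|sigma mu1| `|sigma L1|) (Num.max `|sigma mu2| `|sigma L2|).
  by apply: (ex_max); apply: ex_max; apply: ex.
rewrite /sigma_star; case: asboolP => // Lamc.
by apply: ex_max => //; apply: ex.
Qed.

(** If [sigma] equals -1 at both [mu1] and [L1], strict convexity puts it below -1 at their
    midpoint. *)
Lemma star_le1_witness : star <= 1 -> exists2 lam, Lam lam & sigma lam != -1.
Proof.
move=> s1.
have [sa|?] := eqVneq (sigma mu1) (-1); last first.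
  by exists mu1 => //; left; rewrite lexx ltW.
have [sb|?] := eqVneq (sigma L1) (-1); last first.
  by exists L1 => //; left; rewrite lexx ltW.
exists ((mu1 + L1) / 2); first by left; apply/andP; split; move: lt1; lra.
have : 0 < alpha * (L1 - mu1) ^+ 2.
  by rewrite mulr_gt0 ?alpha_gt0 // exprn_gt0 // subr_gt0.
move: sa sb; rewrite (sigma2_vertex mu1) (sigma2_vertex L1).
rewrite (sigma2_vertex (_ / 2)) => sa sb pos; rewrite lt_eqF //.
rewrite (_ : alpha * _ + _ = (alpha * (mu1 - c) ^+ 2 + sigma c) / 2 +
  (alpha * (L1 - c) ^+ 2 + sigma c) / 2 - alpha * (L1 - mu1) ^+ 2 / 4).
  by rewrite sa sb; move: pos; lra.
by move: (sigma c) c alpha => s v a; field.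
Qed.

End SigmaStar.

(** * Two-sided bounds on the rate factor *)

Section Rate.
Variables (R : realType) (mu1 L1 mu2 L2 m h0 h1 : R).
Hypotheses (mu1_gt0 : 0 < mu1) (lt1 : mu1 < L1) (le12 : L1 <= mu2).
Hypotheses (lt2 : mu2 < L2).
Hypotheses (m0 : 0 < m) (m1 : m < 1) (h0_gt0 : 0 < h0) (h1_gt0 : 0 < h1).

Local Notation Lam := (two_intervals mu1 L1 mu2 L2).
Local Notation star := (sigma_star mu1 L1 mu2 L2 m h0 h1).
Local Notation rate := (rate_factor Lam 2 (hcyc2 h0 h1) m).
Local Notation p := (hb_poly 2 (hcyc2 h0 h1) m).
Local Notation growth s := (s + Num.sqrt (s ^+ 2 - 1)).

(** The free parameter serves two regimes: [S = 1] when [star <= 1], and [S = star] above 1. *)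
Lemma rate_factor_le (S : R) : 1 <= S -> star <= S ->
  (rate <= (Num.sqrt m * Num.sqrt (growth S))%:E)%E.
Proof.
move=> S1 starS.
have [C C0 HC] := hb_poly_upper m0 m1 h0_gt0 h1_gt0 L2 S1.
have Lmu : Lam mu1 by left; rewrite lexx ltW.
have rho0 : 0 < Num.sqrt m * Num.sqrt (growth S).
  by rewrite mulr_gt0 ?sqrtr_gt0 // (lt_le_trans ltr01) // growth_ge1.
apply: (limn_esup_root_le (C := C)) => // t.
  exact: worst_rate_ge0 Lmu.
apply: worst_rate_le => [lam Llam|]; last first.
  by rewrite !mulr_ge0 ?exprn_ge0 // ltW.
apply: HC.
  case: Llam => /andP[le_l l_le]; apply/andP; split.
  - by rewrite (le_trans (ltW mu1_gt0)).
  - by rewrite (le_trans l_le) // (le_trans le12) // ltW.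
  - by rewrite (le_trans (ltW mu1_gt0)) // (le_trans (ltW lt1)) // (le_trans le12).
  - by [].
by apply: le_trans starS; apply: sigma2_le_star.
Qed.

Lemma rate_factor_ge (lam rho : R) : Lam lam -> 0 < rho ->
  (exists2 c, 0 < c & forall N, exists2 t, (N <= t)%N &
    c * rho ^+ t <= `|p lam t|) ->
  (rho%:E <= rate)%E.
Proof.
move=> Llam rho0 [c c0 Hc]; apply: (limn_esup_root_ge c0 rho0) => N.
have [t Nt ct] := Hc N; exists t => //.
by apply: le_trans (worst_rate_ge _ _ _ _ Llam); rewrite lee_fin.
Qed.

Lemma rate_factor_ge_hyperbolic : 1 < star ->
  ((Num.sqrt m * Num.sqrt (growth star))%:E <= rate)%E.
Proof.
move=> s1; have [lam Llam sE] := star_attained m h0 h1 lt1 lt2.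
apply: (rate_factor_ge Llam).
  rewrite mulr_gt0 ?sqrtr_gt0 // (lt_le_trans ltr01) // growth_ge1 //.
  exact: ltW.
by rewrite -sE; apply: hb_poly_lower_hyperbolic => //; rewrite sE.
Qed.

End Rate.

Theorem theorem1 (R : realType) (mu1 L1 mu2 L2 m h0 h1 : R) :
  0 < mu1 -> mu1 < L1 -> L1 <= mu2 -> mu2 < L2 -> L1 - mu1 = L2 - mu2 ->
  0 < m -> m < 1 -> 0 < h0 -> 0 < h1 ->
  let Lam := two_intervals mu1 L1 mu2 L2 in
  let s := sigma_star mu1 L1 mu2 L2 m h0 h1 in
  let rate := rate_factor Lam 2 (hcyc2 h0 h1) m in
  [/\ (s <= 1 -> rate = (Num.sqrt m)%:E),
      (1 < s -> s < (1 + m ^+ 2) / (2 * m) ->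
         rate = (Num.sqrt m * Num.sqrt (s + Num.sqrt (s ^+ 2 - 1)))%:E)
    & ((1 + m ^+ 2) / (2 * m) <= s -> (1%:E <= rate)%E)].
Proof.
move=> mu1_gt0 lt1 le12 lt2 _ m0 m1 h0_gt0 h1_gt0 Lam s rate.
have sm0 : 0 < Num.sqrt m by rewrite sqrtr_gt0.
split=> [s1|s1 _|s_ge].
- apply/eqP; rewrite eq_le; apply/andP; split.
    have := rate_factor_le mu1_gt0 lt1 le12 lt2 m0 m1 h0_gt0 h1_gt0 (lexx 1) s1.
    by rewrite expr1n subrr sqrtr0 addr0 sqrtr1 mulr1.
  have [lam Llam sN1] := star_le1_witness lt1 m0 h0_gt0 h1_gt0 s1.
  apply: (rate_factor_ge Llam sm0); apply: hb_poly_lower_elliptic => //.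
  by apply: le_trans s1; apply: sigma2_le_star.
- apply/eqP; rewrite eq_le; apply/andP; split.
    by apply: rate_factor_le => //; exact: ltW.
  exact: rate_factor_ge_hyperbolic.
- (* At [s = (1 + m^2) / (2 m)] the growth factor [s + sqrt (s^2 - 1)] is [1/m]. *)
  have s_gt1 : 1 < s.
    apply: lt_le_trans s_ge; rewrite ltr_pdivlMr ?mulr_gt0 // mul1r.
    rewrite -subr_gt0 (_ : _ - _ = (1 - m) ^+ 2); last ring.
    by rewrite exprn_gt0 // subr_gt0.
  have := rate_factor_ge_hyperbolic lt1 lt2 m0 m1 s_gt1.
  apply: le_trans; set r := Num.sqrt (_ - 1).
  rewrite lee_fin -sqrtrM ?(ltW m0) // -[leLHS]sqrtr1 ler_wsqrtr //.
  (* The left side is the value of [r] at the threshold, because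
     [(1 + m^2)^2 - (2 m)^2 = (1 - m^2)^2]. *)
  have r_ge : (1 - m ^+ 2) / (2 * m) <= r.
    rewrite -[leLHS]ger0_norm; last first.
      by rewrite divr_ge0 ?mulr_ge0 ?(ltW m0) // subr_ge0 exprn_ile1 ?(ltW m0) ?ltW.
    rewrite -sqrtr_sqr ler_wsqrtr //.
    apply: (@le_trans _ _ (((1 + m ^+ 2) / (2 * m)) ^+ 2 - 1)).
      by rewrite le_eqVlt; apply/orP; left; apply/eqP; field; rewrite gt_eqF.
    rewrite lerB // ler_sqr ?nnegrE //; last by rewrite ltW // (lt_trans ltr01).
    by rewrite divr_ge0 ?mulr_ge0 ?(ltW m0) // addr_ge0 ?sqr_ge0.
  rewrite -[leLHS](mulfV (lt0r_neq0 m0)) ler_wpM2l ?(ltW m0) //.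
  apply: le_trans (lerD s_ge r_ge).
  by rewrite le_eqVlt; apply/orP; left; apply/eqP; field; rewrite gt_eqF.
Qed.
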